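(* Let $n,k,t$ be integers with $0<t<k<n$. Suppose that $n\geq (k-t)\binom{k^2}{t+1}+t$. Let $\mathcal{F}=\{F_1,\ldots,F_m\}$ be a $t$-intersecting, $k$-uniform family of $m$ subsets of $[n]$. Then $$ m\leq \binom{n-t}{k-t}. $$
   Context: $[n]=\{1,2,\ldots,n\}$. A family $\mathcal{F}$ is a set of (distinct) subsets of $[n]$, so $m=|\mathcal{F}|$. A family $\mathcal{F}$ is $k$-uniform if $|F|=k$ for each $F\in\mathcal{F}$. A family $\mathcal{F}$ is $t$-intersecting if $|F\cap F'|\geq t$ whenever $F,F'\in\mathcal{F}$. *)

(* Defs.v *)
From mathcomp Require Import all_boot.

Set Implicit Arguments.
Unset Strict Implicit.
Unset Printing Implicit Defensive.

(* The ground set [n] = {1, ..., n} is represented by 'I_n = {0, ..., n-1}. *)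

Definition uniform (n k : nat) (F : {set {set 'I_n}}) : Prop :=
  forall A, A \in F -> #|A| = k.

Definition t_intersecting (n t : nat) (F : {set {set 'I_n}}) : Prop :=
  forall A B, A \in F -> B \in F -> t <= #|A :&: B|.

(* Main.v *)
Require Import Defs.
From mathcomp Require Import all_boot.
From mathcomp Require Import zify.

Set Implicit Arguments.
Unset Strict Implicit.
Unset Printing Implicit Defensive.

(** Two cases.  If the members of the family share [t] points, they are all
    determined by their remaining [k - t] points, chosen among [n - t].

    Otherwise some set [Y] of at most [3k - 2t <= k ^ 2] points meets every
    member in at least [t + 1] points ([nontrivial_has_core]).  Each member then
    contains one of the ['C(#|Y|, t.+1)] subsets of [Y] of size [t + 1], and at
    most ['C(n - t - 1, k - t - 1)] members contain a given one
    ([card_family_core]).  Since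
    ['C(n - t, k - t) = (n - t) / (k - t) * 'C(n - t - 1, k - t - 1)], this
    count is within the bound as soon as [(k - t) * 'C(k ^ 2, t.+1) <= n - t],
    which is the assumption on [n]. *)

(** Removing [S] leaves a subset of the complement of [S].  Only an inequality,
    because of truncated subtraction when [k < #|S|]. *)
Lemma card_supersets (T : finType) (S : {set T}) (k : nat) :
  #|[set A : {set T} | S \subset A & #|A| == k]| <= 'C(#|T| - #|S|, k - #|S|).
Proof.
have -> : #|T| - #|S| = #|~: S| by rewrite [RHS]cardsCs setCK.
rewrite -cards_draws.
have injD : {in [set A : {set T} | S \subset A & #|A| == k] &,
             injective (fun A => A :\: S)}.
  move=> A B; rewrite !inE => /andP[sSA _] /andP[sSB _] eqD.
  by rewrite -(setID A S) -(setID B S) eqD (setIidPr sSA) (setIidPr sSB).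
rewrite -(card_in_imset injD); apply/subset_leq_card/subsetP => D /imsetP[A].
rewrite !inE => /andP[sSA /eqP <-] ->.
by rewrite subsetDr cardsDS // eqxx.
Qed.

Lemma exists_subset_card (T : finType) (A : {set T}) (m : nat) :
  m <= #|A| -> exists2 B : {set T}, B \subset A & #|B| = m.
Proof.
case/card_geqP => s [uniq_s size_s sub_s]; exists [set x in s].
  by apply/subsetP => x; rewrite inE; apply: sub_s.
by rewrite cardsE -size_s; apply/card_uniqP.
Qed.

(** Union bound over the [s]-subsets of [Y]: every member contains one. *)
Lemma card_family_core (n k s : nat) (F : {set {set 'I_n}}) (Y : {set 'I_n}) :
    uniform k F -> {in F, forall A, s <= #|A :&: Y|} ->
  #|F| <= 'C(#|Y|, s) * 'C(n - s, k - s).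
Proof.
move=> F_unif F_core.
set draws := [set S : {set 'I_n} | S \subset Y & #|S| == s].
have subF : F \subset
    \bigcup_(S in draws) [set A : {set 'I_n} | S \subset A & #|A| == k].
  apply/subsetP => A FA.
  have [S] := exists_subset_card (F_core A FA).
  rewrite subsetI => /andP[sSA sSY] cardS.
  by apply/bigcupP; exists S; rewrite inE ?sSY ?cardS ?sSA ?(F_unif A FA) /=.
apply: leq_trans (subset_leq_card subF) _.
rewrite -cards_draws -sum_nat_const.
apply: (@leq_trans (\sum_(S in draws)
    #|[set A : {set 'I_n} | S \subset A & #|A| == k]|)).
  elim/big_rec2: _ => [|S m U _ leU]; first by rewrite cards0.
  by apply: leq_trans (leq_card_setU _ _) _; rewrite leq_add2l.
apply: leq_sum => S; rewrite inE => /andP[_ /eqP <-].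
by have := card_supersets S k; rewrite card_ord.
Qed.

(** [H :&: A] has at least [t] points and lies in [H :&: Y], which has at most
    [t], so the two coincide. *)
Lemma trace_sub_member (T : finType) (t : nat) (H A Y : {set T}) :
  A \subset Y -> t <= #|H :&: A| -> #|H :&: Y| <= t -> H :&: Y \subset A.
Proof.
move=> sAY le_tHA le_HYt.
suff /eqP <- : H :&: A == H :&: Y by apply: subsetIr.
by rewrite eqEcard setIS //= (leq_trans le_HYt).
Qed.

(** Take [A] in [F].  If [Y := A] does not do, some [B] in [F] meets [A] in
    exactly [t] points, and some [G] in [F] misses one of these points.  Take
    [Y := A :|: B :|: G]; both [B] and [G] add at most [k - t] points to [A].
    If a member [H] met [Y] in only [t] points, these would all lie in [A], in
    [B] and in [G]; but [A :&: B :&: G] has fewer than [t] points. *)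
Lemma nontrivial_has_core (n k t : nat) (F : {set {set 'I_n}}) :
    t <= k -> t_intersecting t F -> uniform k F ->
    (forall S : {set 'I_n}, #|S| = t -> exists2 G, G \in F & ~~ (S \subset G)) ->
  exists2 Y : {set 'I_n}, #|Y| <= k + 2 * (k - t) &
    {in F, forall H, t < #|H :&: Y|}.
Proof.
move=> le_tk F_inter F_unif F_nontriv.
have [->|[A FA]] := set_0Vmem F.
  by exists set0 => [|H]; rewrite ?cards0 ?inE.
have [/forall_inP coreA|] := boolP [forall H in F, t < #|H :&: A|].
  by exists A; rewrite ?(F_unif A FA) ?leq_addr.
rewrite negb_forall_in => /exists_inP[B FB]; rewrite -leqNgt => le_BAt.
have cardAB : #|A :&: B| = t.
  by apply/eqP; rewrite eqn_leq F_inter // setIC le_BAt.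
have [G FG nsABG] := F_nontriv _ cardAB.
have leqU (X C : {set 'I_n}) : A \subset X -> C \in F ->
    #|X :|: C| <= #|X| + (k - t).
  move=> sAX FC; rewrite cardsU (F_unif C FC).
  have: t <= #|X :&: C| by apply: leq_trans (F_inter A C FA FC) _;
    apply/subset_leq_card/setSI.
  lia.
exists (A :|: B :|: G).
  have := leqU (A :|: B) G (subsetUl _ _) FG.
  have := leqU A B (subxx _) FB; rewrite (F_unif A FA); lia.
move=> H FH; rewrite ltnNge; apply/negP => le_HYt.
have trace C : C \in F -> C \subset A :|: B :|: G ->
    H :&: (A :|: B :|: G) \subset C.
  by move=> FC sCY; apply: (trace_sub_member sCY (F_inter H C FH FC)).
have sA : A \subset A :|: B :|: G by rewrite -setUA subsetUl.
have sB : B \subset A :|: B :|: G by rewrite (setUC A) -setUA subsetUl.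
have sG : G \subset A :|: B :|: G by rewrite subsetUr.
case/negP: nsABG; suff /eqP <- : H :&: (A :|: B :|: G) == A :&: B by exact: trace.
rewrite eqEcard subsetI !trace //= cardAB.
by apply: leq_trans (F_inter H A FH FA) _; apply/subset_leq_card/setIS.
Qed.

Theorem corollary1p14 (n k t : nat) (t_gt0 : 0 < t) (lt_tk : t < k)
    (lt_kn : k < n) (n_large : (k - t) * 'C(k ^ 2, t.+1) + t <= n)
    (F : {set {set 'I_n}}) (F_inter : t_intersecting t F)
    (F_unif : uniform k F) :
  #|F| <= 'C(n - t, k - t).
Proof.
have [/existsP[S /andP[/eqP cardS /forall_inP sSF]]|nontriv] :=
  boolP [exists S : {set 'I_n}, (#|S| == t) && [forall A in F, S \subset A]].
  have := card_supersets S k; rewrite card_ord cardS; apply: leq_trans.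
  apply/subset_leq_card/subsetP => A FA.
  by rewrite inE sSF // (F_unif A FA) eqxx.
have [S cardS|Y leY coreY] :=
    @nontrivial_has_core n k t F (ltnW lt_tk) F_inter F_unif.
  move: nontriv; rewrite negb_exists => /forallP/(_ S).
  by rewrite cardS eqxx negb_forall_in => /exists_inP[G]; exists G.
(* [3 * k - 2 * t <= 3 * k - 2 = k ^ 2 - (k - 1) * (k - 2)], as [0 < t < k]. *)
have leYk2 : #|Y| <= k ^ 2 by apply: leq_trans leY _; nia.
have leF := card_family_core F_unif coreY.
have kt_gt0 : 0 < k - t by rewrite subn_gt0.
rewrite -(leq_pmul2l kt_gt0) -{2 3}(prednK kt_gt0) -mul_bin_diag -!subnS.
apply: leq_trans (leq_mul (leqnn _) leF) _; rewrite mulnA leq_mul2r.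
apply/orP; right; rewrite leq_subRL; last lia.
rewrite addnC; apply: leq_trans n_large.
by rewrite leq_add2r leq_mul2l leq_bin2l ?orbT.
Qed.
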